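(* On the filtered space described in the context, for every $\beta\in(0,1]$ and $n\in\mathbb N$, $R_{\beta,n}$ is a conditional e-variable for $\mathbb P_0$ at time $n$, and with $s=\frac{1-\beta}\beta$, $$\mathbb E_{\mathbb P_1}\big[R_{\beta,n}^{-s}\mid\mathcal F_{n-1}\big]\ =\ e^{-\lambda_n(\beta)}\qquad\mathbb P_1\text{-a.s.}$$
   Context: Setting: $(\Omega,\mathcal F)$ is a measurable space with a filtration $(\mathcal F_t)_{t\in\mathbb N_0}$, $\mathcal F_0=\{\emptyset,\Omega\}$, and $\mathbb P_0,\mathbb P_1$ are probability measures on it. Standing assumption: for every $t\in\mathbb N=\{1,2,\dots\}$, $\mathbb P_1\ll\mathbb P_0$ on $\mathcal F_t$ and $\mathrm{KL}(\mathbb P_1|_{\mathcal F_t}\|\mathbb P_0|_{\mathcal F_t})<\infty$. $L_t:=\frac{d\mathbb P_1|_{\mathcal F_t}}{d\mathbb P_0|_{\mathcal F_t}}$, $L_0=1$; $R_t:=L_t/L_{t-1}$ on $\{L_{t-1}>0\}$, $R_t:=1$ elsewhere. For $\beta\in(0,1]$: $Z_{\beta,t}:=\mathbb E_{\mathbb P_0}[R_t^\beta\mid\mathcal F_{t-1}]$, $\lambda_t(\beta):=-\frac1\beta\log Z_{\beta,t}$, and $R_{\beta,t}:=R_t^\beta/Z_{\beta,t}$ on $\{0<Z_{\beta,t}<\infty\}$, $R_{\beta,t}:=1$ elsewhere. A conditional e-variable for $\mathbb P_0$ at time $t$ is an $\mathcal F_t$-measurable $E_t:\Omega\to[0,\infty]$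 with $\mathbb E_{\mathbb P_0}[E_t\mid\mathcal F_{t-1}]\le1$ $\mathbb P_0$-a.s. Conventions: $x^0=1$; $0^{-s}=+\infty$ for $s>0$. *)

(* Defs.v *)
From HB Require Import structures.
From mathcomp Require Import all_boot all_order all_algebra.
From mathcomp Require Import all_classical all_reals all_analysis.
From mathcomp Require Import measurable_realfun.

Set Implicit Arguments.
Unset Strict Implicit.
Unset Printing Implicit Defensive.
Import Order.TTheory GRing.Theory Num.Theory.
Import numFieldNormedType.Exports.
Local Open Scope classical_set_scope.
Local Open Scope ring_scope.

Record subSigmaAlgebra d (T : measurableType d) := SubSigmaAlgebra {
  subsigma_sets :> set (set T) ;
  subsigmaP : sigma_algebra setT subsigma_sets ;
  subsigma_sub : subsigma_sets `<=` measurable }.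

(* [g_sigma_algebraType G] is the measurable space (T, G), since G, being
   already a sigma-algebra, is the sigma-algebra it generates. *)
Lemma measurable_subsigma d (T : measurableType d) (G : subSigmaAlgebra T) :
  (measurable : set (set (g_sigma_algebraType G))) = G.
Proof. exact/measurable_g_measurableTypeE/subsigmaP. Qed.

Definition measurable_wrt d (T : measurableType d) (R : realType)
    (G : subSigmaAlgebra T) (f : T -> \bar R) : Prop :=
  @measurable_fun _ _ (g_sigma_algebraType G) _ setT f.

Definition is_filtration d (T : measurableType d)
    (F : nat -> subSigmaAlgebra T) : Prop :=
  forall s t, (s <= t)%N -> F s `<=` F t.

Section restriction.
Context d (T : measurableType d) (R : realType).
Variables (P : probability T R) (G : subSigmaAlgebra T).
Local Open Scope ereal_scope.

(* The restriction of P to G, as a probability on (T, G). *)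
Definition prestr : set (g_sigma_algebraType G) -> \bar R := fun A => P A.

Let prestr0 : prestr set0 = 0. Proof. exact: measure0. Qed.

Let prestr_ge0 A : 0 <= prestr A. Proof. exact: measure_ge0. Qed.

Let sub_measurable (A : set (g_sigma_algebraType G)) :
  measurable A -> (measurable : set (set T)) A.
Proof. by rewrite measurable_subsigma; exact: subsigma_sub. Qed.

Let prestr_semi_sigma_additive : semi_sigma_additive prestr.
Proof.
move=> A mA tA mUA; apply: (@measure_semi_sigma_additive _ _ _ P) => //.
- by move=> i; exact/sub_measurable.
- exact/sub_measurable.
Qed.

HB.instance Definition _ := isMeasure.Build _ (g_sigma_algebraType G) R prestr
  prestr0 prestr_ge0 prestr_semi_sigma_additive.

Let prestrT : prestr setT = 1. Proof. exact: probability_setT. Qed.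

HB.instance Definition _ :=
  Measure_isProbability.Build _ (g_sigma_algebraType G) R prestr prestrT.

End restriction.
Arguments prestr {d T R} P G _.

Section densities.
Context d (T : measurableType d) (R : realType).
Local Open Scope ereal_scope.

Definition is_density (nu mu : probability T R) (f : T -> R) : Prop :=
  [/\ measurable_fun setT f, (forall x, (0 <= f x)%R) &
      forall A, measurable A -> nu A = \int[mu]_(x in A) (f x)%:E].

Local Open Scope charge_scope.

(* The library's derivative ['d nu '/d mu] may be negative on a mu-null, hence
   nu-null, set, which does not affect the integral against nu.
   The negative part of the integrand is always nu-integrable, so the value
   below is never of the form (+oo) - (+oo). *)
Definition KL (nu mu : probability T R) : \bar R :=
  if `[< nu `<< mu >]
  then \int[nu]_x lne (('d (charge_of_finite_measure nu) '/d mu) x)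
  else +oo.

End densities.

Section conditional_expectation.
Context d (T : measurableType d) (R : realType).
Local Open Scope ereal_scope.

(* Y is a version of the conditional expectation E_P[X | G] of a measurable
   X : T -> [0, +oo], which is not required to be integrable. *)
Definition is_cond_exp (P : probability T R) (G : subSigmaAlgebra T)
    (X Y : T -> \bar R) : Prop :=
  [/\ measurable_wrt G Y, (forall x, 0 <= Y x) &
      forall A, subsigma_sets G A -> \int[P]_(x in A) Y x = \int[P]_(x in A) X x].

Lemma measurable_wrt_fun (G : subSigmaAlgebra T) (f : T -> \bar R) :
  measurable_wrt G f -> measurable_fun setT f.
Proof.
move=> mf _ B mB; apply: (@subsigma_sub _ _ G).
by rewrite -measurable_subsigma; exact: mf.
Qed.

Lemma integral_prestr (P : probability T R) (G : subSigmaAlgebra T)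
    (f : T -> \bar R) (A : set T) :
  measurable_wrt G f -> (forall x, 0 <= f x) -> subsigma_sets G A ->
  \int[prestr P G]_(x in A) f x = \int[P]_(x in A) f x.
Proof.
move=> mf f0 GA.
have mid : @measurable_fun _ _ T (g_sigma_algebraType G) setT id.
  by move=> _ B; rewrite measurable_subsigma setTI; exact: subsigma_sub.
have mA : @measurable _ (g_sigma_algebraType G) A by rewrite measurable_subsigma.
have := @ge0_integral_pushforward _ _ _ _ _ _ mid P A f mA.
rewrite preimage_id => <- //.
exact: (@measurable_funS _ _ (g_sigma_algebraType G) _ setT).
Qed.

Lemma cond_exp_exists_bounded (P : probability T R) (G : subSigmaAlgebra T)
    (X : T -> \bar R) :
  measurable_fun setT X -> (forall x, 0 <= X x) -> (forall x, X x <= 1) ->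
  exists Y, is_cond_exp P G X Y.
Proof.
move=> mX X0 X1.
pose nu (A : set (g_sigma_algebraType G)) := \int[P]_(x in A) X x.
have sub_measurable (A : set (g_sigma_algebraType G)) :
    measurable A -> (measurable : set (set T)) A.
  by rewrite measurable_subsigma; exact: subsigma_sub.
have nu0 : nu set0 = 0 by exact: integral_set0.
have nu_ge0 A : 0 <= nu A by exact: integral_ge0.
have nu_sigma : semi_sigma_additive nu.
  move=> A mA tA mUA; rewrite /nu ge0_integral_bigcup//.
  - by apply: is_cvg_ereal_nneg_natsum_cond => n _ _; exact: integral_ge0.
  - by move=> i; exact/sub_measurable.
  - exact: measurable_funTS.
have nu_le A : measurable A -> nu A <= P A.
  move=> /sub_measurable mA; rewrite -[leRHS]mul1e -integral_cst//.
  by apply: ge0_le_integral => //; exact: measurable_funTS.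
have nu_fin : fin_num_fun nu.
  move=> A mA; rewrite ge0_fin_numE//; apply: le_lt_trans (nu_le _ mA) _.
  by rewrite ltey_eq fin_num_measure//; exact: sub_measurable.
pose nuM := isMeasure.Build _ _ _ nu nu0 nu_ge0 nu_sigma.
pose nu_meas : {measure set (g_sigma_algebraType G) -> \bar R} := HB.pack nu nuM.
pose nuF := Measure_isFinite.Build _ _ _ nu_meas nu_fin.
pose nu_fm : {finite_measure set (g_sigma_algebraType G) -> \bar R} :=
  HB.pack nu nuM nuF.
have dom : nu_fm `<< prestr P G.
  apply/null_content_dominatesP => A mA PA0; apply/eqP.
  by rewrite eq_le nu_ge0 andbT; apply: le_trans (nu_le _ mA) _; rewrite -PA0.
have [f [f0 _ fi fE]] := radon_nikodym_sigma_finite dom.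
have mf := measurable_int _ fi.
exists f; split => // A GA; rewrite -(@integral_prestr P G)// -fE//.
by rewrite measurable_subsigma.
Qed.

Let slice (X : T -> \bar R) (k : nat) (x : T) : \bar R :=
  mine (X x) k.+1%:R%:E - mine (X x) k%:R%:E.

Let mine_fin (a : \bar R) k : 0 <= a -> mine a k%:R%:E \is a fin_num.
Proof.
move=> a0; rewrite ge0_fin_numE; last by rewrite le_min a0 lee_fin/=.
by rewrite gt_min ltry orbT.
Qed.

Let sum_slice X n x : 0 <= X x -> \sum_(0 <= k < n) slice X k x = mine (X x) n%:R%:E.
Proof.
move=> X0; elim: n => [|n ih]; first by rewrite big_geq//; apply/esym/min_idPr.
by rewrite big_nat_recr//= ih /slice [LHS]addeC subeK// mine_fin.
Qed.

Let series_slice X x : 0 <= X x -> \sum_(0 <= k <oo) slice X k x = X x.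
Proof.
move=> X0; apply/cvg_lim => //.
rewrite (_ : (fun n => _) = (fun n => mine (X x) n%:R%:E)); last first.
  by apply/funext => n; exact: sum_slice.
case: (X x) X0 => [r| |]//= r0.
- apply: (@cvg_trans _ ((fun=> r%:E) @ \oo)); last exact: cvg_cst.
  apply: near_eq_cvg; near=> n; apply/esym/min_idPl; rewrite lee_fin.
  by near: n; exact: nbhs_infty_ger.
- rewrite (_ : (fun n => _) = (fun n => n%:R%:E)); first exact/cvgenyP.
  by apply/funext => n; apply/min_idPr; rewrite leey.
Unshelve. all: by end_near. Qed.

Lemma cond_exp_exists (P : probability T R) (G : subSigmaAlgebra T)
    (X : T -> \bar R) :
  measurable_fun setT X -> (forall x, 0 <= X x) ->
  exists Y, is_cond_exp P G X Y.
Proof.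
move=> mX X0.
have mS k : measurable_fun setT (slice X k).
  by apply: emeasurable_funB; apply: measurable_mine.
have S0 k x : 0 <= slice X k x.
  rewrite sube_ge0 ?mine_fin// le_min ge_min lexx/=.
  by rewrite ge_min lee_fin ler_nat leqnSn orbT.
have S1 k x : slice X k x <= 1.
  rewrite leeBlDr ?mine_fin// ge_min.
  case: (leP (X x) k%:R%:E) => _; first by rewrite leeDr.
  by rewrite orbC -EFinD lee_fin -natr1 addrC lexx.
have /choice[Y HY] k : exists Y, is_cond_exp P G (slice X k) Y.
  exact: cond_exp_exists_bounded.
exists (fun x => \sum_(0 <= k <oo) Y k x); split.
- by apply: ge0_emeasurable_sum => // k *; have [] := HY k.
- by move=> x; apply: nneseries_ge0 => k *; have [] := HY k.
move=> A GA; have mA := subsigma_sub GA.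
rewrite integral_nneseries//; last 2 first.
- by move=> k; have [/measurable_wrt_fun/measurable_funTS] := HY k.
- by move=> k *; have [] := HY k.
transitivity (\sum_(0 <= k <oo) \int[P]_(x in A) slice X k x).
  by apply: eq_eseriesr => k _; have [_ _] := HY k; apply.
rewrite -integral_nneseries//; last by move=> k; exact: measurable_funTS.
by apply: eq_integral => x _; exact: series_slice.
Qed.

End conditional_expectation.

Section process.
Context d (T : measurableType d) (R : realType).
Local Open Scope ereal_scope.

(* The bound is required of every version of the conditional expectation;
   versions exist by [cond_exp_exists]. *)
Definition cond_evariable (P : probability T R) (F : nat -> subSigmaAlgebra T)
    (t : nat) (E : T -> \bar R) : Prop :=
  [/\ measurable_wrt (F t) E, (forall x, 0 <= E x) &
      forall Y, is_cond_exp P (F t.-1) E Y -> {ae P, forall x, Y x <= 1}].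

(* R_t, for t >= 1. *)
Definition lik_ratio (L : nat -> T -> R) (t : nat) (x : T) : R :=
  (if 0 < L t.-1 x then L t x / L t.-1 x else 1)%R.

Definition lik_ratio_pow (L : nat -> T -> R) (beta : R) (t : nat) (x : T) : \bar R :=
  (lik_ratio L t x `^ beta)%:E.

(* In the next two definitions Z stands for a version of Z_{beta,t}. *)
Definition lambda (beta : R) (Z : T -> \bar R) (x : T) : \bar R :=
  - ((beta^-1)%:E * lne (Z x)).

Definition lik_ratio_tilt (L : nat -> T -> R) (beta : R) (t : nat)
    (Z : T -> \bar R) (x : T) : \bar R :=
  if 0 < Z x < +oo then lik_ratio_pow L beta t x / Z x else 1.

(* y^{-s} for y in [0, +oo] and s >= 0. The library's [0 `^ (- s)] is 0 for
   s > 0; with the inverse of \bar R, for which 0^-1 = +oo and (+oo)^-1 = 0,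
   one gets 0^{-s} = +oo for s > 0 and y^{-0} = 1. *)
Definition negpow (y : \bar R) (s : R) : \bar R := (y `^ s)^-1.

End process.

(* Main.v *)
(* Write G = F_{n-1}, X = R_n^beta, and let Z be a version of E_{P0}[X | G].
   Pulling the G-measurable factor Z^{-1} out of E_{P0}[X / Z | G] shows that
   R_{beta,n} has conditional expectation exactly 1. For the second claim, on
   the event {0 < Z < +oo, L_{n-1} > 0}, which belongs to G and has full
   P1-measure,
     R_{beta,n}^{-s} L_n = Z^s L_{n-1} R_n^beta,
   because beta s = 1 - beta and L_n = L_{n-1} R_n. Passing from P1 to P0 on F_n
   by the density L_n, replacing R_n^beta by Z, and passing back to P1 on G by
   L_{n-1} turns the integral of R_{beta,n}^{-s} over a set of G into that of
   Z^{s+1} = Z^{1/beta} = exp (- lambda_n(beta)). *)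

Require Import Defs.
From mathcomp Require Import all_boot all_order all_algebra.
From mathcomp Require Import all_classical all_reals all_analysis.
From mathcomp Require Import measurable_realfun.
Set Implicit Arguments.
Unset Strict Implicit.
Unset Printing Implicit Defensive.
Import Order.TTheory GRing.Theory Num.Theory.
Import numFieldNormedType.Exports.
Local Open Scope classical_set_scope.
Local Open Scope ring_scope.

(** * Pull-out, change of measure and uniqueness of conditional expectations *)

Section sub_sigma_algebra.
Context d (T : measurableType d) (R : realType) (G : subSigmaAlgebra T).
Local Open Scope ereal_scope.
Import HBNNSimple.

Lemma measurable_subsigmaP (A : set T) :
  @measurable _ (g_sigma_algebraType G) A = subsigma_sets G A.
Proof. by rewrite measurable_subsigma. Qed.

Lemma subsigma_preimage (f : T -> \bar R) (B : set (\bar R)) :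
  measurable_wrt G f -> measurable B -> subsigma_sets G (f @^-1` B).
Proof.
by move=> mf mB; rewrite -measurable_subsigmaP -[_ @^-1` _]setTI; exact: mf.
Qed.

Lemma subsigmaT : subsigma_sets G setT.
Proof. by rewrite -measurable_subsigmaP; exact: measurableT. Qed.

Lemma subsigmaI (A B : set T) :
  subsigma_sets G A -> subsigma_sets G B -> subsigma_sets G (A `&` B).
Proof. by rewrite -!measurable_subsigmaP; exact: measurableI. Qed.

Lemma measurable_wrtS (H : subSigmaAlgebra T) (f : T -> \bar R) :
  G `<=` H -> measurable_wrt G f -> measurable_wrt H f.
Proof.
move=> GH mf _ B mB; rewrite measurable_subsigma setTI.
exact/GH/subsigma_preimage.
Qed.

Lemma negligible_prestr (P : probability T R) (A : set T) :
  (prestr P G).-negligible A -> P.-negligible A.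
Proof.
move=> [B [mB PB AB]]; exists B; split => //.
by apply: (@subsigma_sub _ _ G); rewrite -measurable_subsigmaP.
Qed.

(** The level sets of [h] lie in [G], so splitting along its finitely many values leaves only
    integrals of [X] over sets of [G], the only integrals that a conditional expectation
    controls. *)
Lemma integral_nnsfun_mule (P : {measure set T -> \bar R}) (X : T -> \bar R)
    (h : {nnsfun (g_sigma_algebraType G) >-> R}) (A : set T) :
  measurable_fun setT X -> (forall x, 0 <= X x) -> subsigma_sets G A ->
  \int[P]_(x in A) ((h x)%:E * X x) =
  \sum_(y \in range h) (y%:E * \int[P]_(x in A `&` h @^-1` [set y]) X x).
Proof.
move=> mX X0 GA; have mA := subsigma_sub GA.
have Gh (y : R) : subsigma_sets G (h @^-1` [set y]).
  by rewrite -measurable_subsigmaP; exact: measurable_sfunP.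
have mh (y : R) : measurable (h @^-1` [set y] : set T) by exact: subsigma_sub.
have m1 (y : R) : measurable_fun A
    (fun x : T => (\1_(h @^-1` [set y]) x)%:E : \bar R).
  by apply/measurable_EFinP/measurable_funTS; exact: measurable_indic.
have y0 (y : R) : y \in range h -> (0 <= y)%R by rewrite inE => -[t _ <-].
transitivity (\int[P]_(x in A) (\sum_(y \in range h)
    (y * \1_(h @^-1` [set y]) x)%:E * X x)).
  apply: eq_integral => x _.
  rewrite -ge0_mule_fsuml => [|y]; last exact: nnfun_muleindic_ge0.
  by rewrite fsumEFin//; congr (_%:E * _); exact: (fimfunE h x).
rewrite ge0_integral_fsum//; last 2 first.
- move=> y; apply: emeasurable_funM; last exact: measurable_funTS.
  by under eq_fun do rewrite EFinM; exact: measurable_funeM.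
- by move=> y x _; rewrite mule_ge0// nnfun_muleindic_ge0.
apply: eq_fsbigr => y yh; under eq_integral do rewrite EFinM -muleA.
rewrite ge0_integralZl//; last 3 first.
- by apply: emeasurable_funM => //; exact: measurable_funTS.
- by move=> x _; rewrite mule_ge0// lee_fin.
- by rewrite lee_fin y0.
congr (_ * _); rewrite integral_mkcondr; apply: eq_integral => x _.
by rewrite patchE indicE; case: ifPn => _; rewrite ?mul1e ?mul0e.
Qed.

(** Monotone convergence along simple functions that are measurable for [G] itself, not merely for
    the ambient sigma-algebra. *)
Lemma cvg_integral_nnsfun_mule (P : {measure set T -> \bar R})
    (X g : T -> \bar R) (mg : measurable_wrt G g) (A : set T) :
  measurable_fun setT X -> (forall x, 0 <= X x) -> (forall x, 0 <= g x) ->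
  subsigma_sets G A ->
  let h := nnsfun_approx (@measurableT _ (g_sigma_algebraType G)) mg in
  \int[P]_(x in A) ((h n x)%:E * X x) @[n --> \oo] -->
  \int[P]_(x in A) (g x * X x).
Proof.
move=> mX X0 g0 GA h; have mA := subsigma_sub GA.
have ndh (x : T) m n : (m <= n)%N -> (h m x)%:E <= (h n x)%:E.
  move=> mn; rewrite lee_fin.
  by have /lefP := nd_nnsfun_approx measurableT mg mn; exact.
have h0 (x : T) n : 0 <= (h n x)%:E by rewrite lee_fin; exact: fun_ge0.
have hg (x : T) : (h n x)%:E @[n --> \oo] --> g x.
  by apply: cvg_nnsfun_approx => // y _; exact: g0.
(* The product is not continuous at 0 times +oo, so zeros are treated apart: where [g] vanishes, so
   does every [h n], being increasing with limit 0. *)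
have hX (x : T) : limn (fun n => (h n x)%:E * X x) = g x * X x.
  apply/cvg_lim => //; have [X0x|X0x] := eqVneq (X x) 0.
    by rewrite X0x mule0; under eq_fun do rewrite mule0; exact: cvg_cst.
  have [g0x|g0x] := eqVneq (g x) 0.
    rewrite g0x mul0e (_ : (fun _ => _) = cst 0); first exact: cvg_cst.
    apply/funext => n /=; suff -> : (h n x)%:E = 0 by rewrite mul0e.
    apply/eqP; rewrite eq_le h0 andbT -g0x.
    rewrite -(cvg_lim _ (hg x))//; apply: lime_ge.
      by apply/cvg_ex; exists (g x).
    by near=> m; apply: ndh; near: m; exact: nbhs_infty_ge.
  apply: (@cvgeM _ _ _ _ (fun n => (h n x)%:E) (cst (X x))) => //;
    last exact: cvg_cst.
  by apply: neq0_mule_def; rewrite mule_eq0 negb_or g0x.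
under eq_integral do rewrite -hX.
apply: cvg_monotone_convergence => //.
- move=> n; apply: emeasurable_funM; last exact: measurable_funTS.
  apply: measurable_funTS; apply: (@measurable_wrt_fun _ _ _ G).
  exact/measurable_EFinP/measurable_funP.
- by move=> n x _; exact: mule_ge0.
- by move=> x _ m n mn; apply: lee_wpmul2r => //; exact: ndh.
Unshelve. all: by end_near. Qed.

(* The pull-out property of conditional expectations (P = Q) and the change of
   measure by a density (X = 1) are both instances. *)
Lemma eq_integral_mule (P Q : {measure set T -> \bar R}) (X Z g : T -> \bar R) :
  measurable_fun setT X -> (forall x, 0 <= X x) ->
  measurable_fun setT Z -> (forall x, 0 <= Z x) ->
  (forall A, subsigma_sets G A ->
    \int[P]_(x in A) X x = \int[Q]_(x in A) Z x) ->
  measurable_wrt G g -> (forall x, 0 <= g x) ->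
  forall A, subsigma_sets G A ->
  \int[P]_(x in A) (g x * X x) = \int[Q]_(x in A) (g x * Z x).
Proof.
move=> mX X0 mZ Z0 XZ mg g0 A GA.
have /cvg_lim <- // := @cvg_integral_nnsfun_mule P _ _ mg _ mX X0 g0 GA.
have /cvg_lim <- // := @cvg_integral_nnsfun_mule Q _ _ mg _ mZ Z0 g0 GA.
congr (limn _); apply/funext => n; rewrite !integral_nnsfun_mule//.
apply: eq_fsbigr => y _; rewrite XZ//; apply: subsigmaI => //.
by rewrite -measurable_subsigmaP; exact: measurable_sfunP.
Qed.

(** [X] may have infinite integral. Cutting down to the event [Y <= k], which lies in [G], makes [Y]
    integrable there, and integrable functions are determined a.e. by their integrals over sets of
    [G]. *)
Lemma cond_exp_ae_unique_le (P : probability T R) (X Y Y' : T -> \bar R)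
    (k : nat) :
  is_cond_exp P G X Y -> is_cond_exp P G X Y' ->
  {ae P, forall x, Y x <= k%:R%:E -> Y x = Y' x}.
Proof.
move=> [mY Y0 YE] [mY' Y'0 Y'E].
pose D : set (g_sigma_algebraType G) := [set x | Y x <= k%:R%:E].
have GD : subsigma_sets G D.
  apply: (@subsigma_preimage Y [set y | y <= k%:R%:E]) => //.
  by rewrite -set_itvNyc; exact: emeasurable_itv.
have mD : measurable D by rewrite measurable_subsigmaP.
(* The comparison takes place on the space (T, G), since the two integrals are known to agree on
   sets of [G] only. *)
suff : ae_eq (prestr P G) D Y Y' by exact: negligible_prestr.
apply: (@integral_ae_eq _ (g_sigma_algebraType G) R (prestr P G) D mD Y' Y).
- apply/integrableP; split; first exact: measurable_funTS.
  apply: (@le_lt_trans _ _ (\int[prestr P G]_(x in D) (cst k%:R%:E x))).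
    apply: ge0_le_integral => //.
    + by apply: measurableT_comp => //; exact: measurable_funTS.
    + by move=> x Dx; rewrite gee0_abs.
  rewrite integral_cst//; apply: (@le_lt_trans _ _ (k%:R%:E * 1)).
    by apply: lee_wpmul2l; [rewrite lee_fin|exact: probability_le1].
  by rewrite mule1 ltry.
- exact: measurable_funTS.
- move=> E ED; rewrite measurable_subsigmaP => GE.
  by rewrite !integral_prestr// YE// Y'E.
Qed.

(** Letting k grow settles the points where [Y] is finite, and exchanging the two versions those
    where [Y'] is finite; elsewhere both are +oo. *)
Lemma cond_exp_ae_unique (P : probability T R) (X Y Y' : T -> \bar R) :
  is_cond_exp P G X Y -> is_cond_exp P G X Y' -> {ae P, forall x, Y x = Y' x}.
Proof.
move=> cY cY'.
have H (U V : T -> \bar R) : is_cond_exp P G X U -> is_cond_exp P G X V ->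
    {ae P, forall x, U x < +oo -> U x = V x}.
  move=> cU cV; have [_ U0 _] := cU.
  have : {ae P, forall x k, U x <= k%:R%:E -> U x = V x}.
    by apply/ae_foralln => k; exact: cond_exp_ae_unique_le cU cV.
  apply: filterS => x Hx Uoo; apply: (Hx (Num.truncn (fine (U x))).+1).
  rewrite -[leLHS]fineK ?ge0_fin_numE// lee_fin.
  exact: (ltW (truncnS_gt _)).
move: (H _ _ cY cY') (H _ _ cY' cY); apply: filterS2 => x YY' Y'Y.
have := leey (Y x); rewrite le_eqVlt => /predU1P[Yoo|/YY'//].
have := leey (Y' x); rewrite le_eqVlt => /predU1P[->//|/Y'Y//].
Qed.

End sub_sigma_algebra.

(** * Inverses, splitting of integrals, and the exponential of lambda *)

Lemma measurable_inve_ge0 d (T : measurableType d) (R : realType)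
    (f : T -> \bar R) :
  measurable_fun setT f -> (forall x, 0 <= f x)%E ->
  measurable_fun setT (fun x => (f x)^-1)%E.
Proof.
move=> mf f0.
(* The inverse is the power -1 at positive finite values only; 0 and +oo are split off by measurable
   tests. *)
rewrite (_ : (fun _ => _) = (fun x => if f x == 0 then +oo else
    if f x == +oo then 0 else f x `^ (-1))%E); last first.
  apply/funext => x; case: (f x) (f0 x) => [r| |]//= r0.
  rewrite inver eqe; case: ifPn => // r_neq0.
  by rewrite /poweR -powR_inv1.
apply: measurable_fun_ifT => //; first exact: measurable_fun_eqe.
apply: measurable_fun_ifT => //; first exact: measurable_fun_eqe.
exact: measurableT_comp (measurable_poweR _) mf.
Qed.

Lemma ge0_integral_setIC d (T : measurableType d) (R : realType)
    (P : {measure set T -> \bar R}) (f : T -> \bar R) (A B : set T) :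
  measurable A -> measurable B -> measurable_fun setT f ->
  (forall x, 0 <= f x)%E ->
  (\int[P]_(x in A) f x =
   \int[P]_(x in A `&` B) f x + \int[P]_(x in A `&` ~` B) f x)%E.
Proof.
move=> mA mB mf f0; rewrite -ge0_integral_setU//.
- by rewrite -setIUr setUv setIT.
- exact: measurableI.
- by apply: measurableI => //; exact: measurableC.
- exact: measurable_funTS.
- by apply/disj_setPS => x [[_ ?] [_]].
Qed.

Lemma ge0_integral_full d (T : measurableType d) (R : realType)
    (P : {measure set T -> \bar R}) (f : T -> \bar R) (A B : set T) :
  measurable A -> measurable B -> measurable_fun setT f ->
  (forall x, 0 <= f x)%E -> P (~` B) = 0%E ->
  (\int[P]_(x in A) f x = \int[P]_(x in A `&` B) f x)%E.
Proof.
move=> mA mB mf f0 PB.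
rewrite (@ge0_negligible_integral _ _ _ P A (~` B))//.
- by rewrite setDE setCK.
- exact: measurableC.
- exact: measurable_funTS.
Qed.

(** Beyond exp (log z / beta), the boundary values matter: both sides are 0 at [Z x = 0] and +oo at
    [Z x = +oo], so the identity has no exceptional set. *)
Lemma expeR_lambda d (T : measurableType d) (R : realType) (beta : R)
    (Z : T -> \bar R) (x : T) : 0 < beta -> (0 <= Z x)%E ->
  (expeR (- lambda beta Z x) = Z x `^ beta^-1)%E.
Proof.
move=> beta_gt0; rewrite /lambda oppeK; case: (Z x) => [z| |]// z0.
- have [->|z_neq0] := eqVneq z 0.
    rewrite le0_lneNy// mulrNy gtr0_sg ?invr_gt0// mul1e /= powR0//.
    by rewrite gt_eqF ?invr_gt0.
  have z_gt0 : 0 < z by rewrite lt_neqAle eq_sym z_neq0 -lee_fin.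
  by rewrite lne_EFin// -EFinM /= /powR (negbTE z_neq0).
- by rewrite mulry gtr0_sg ?invr_gt0// mul1e /= gt_eqF ?invr_gt0.
Qed.

Lemma lik_ratio_tilt_ge0 d (T : measurableType d) (R : realType)
    (L : nat -> T -> R) (beta : R) (n : nat) (Z : T -> \bar R) (x : T) :
  (0 <= Z x)%E -> (0 <= lik_ratio_tilt L beta n Z x)%E.
Proof.
move=> Z0; rewrite /lik_ratio_tilt; case: ifP => // _.
by rewrite mule_ge0 ?inve_ge0// lee_fin powR_ge0.
Qed.

(** * Densities on a sub-sigma-algebra, integrated on the ambient space *)

Definition density_on d (T : measurableType d) (R : realType)
    (P1 P0 : probability T R) (G : subSigmaAlgebra T) (f : T -> R) : Prop :=
  [/\ measurable_wrt G (EFin \o f), (forall x, 0 <= f x) &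
      forall A, subsigma_sets G A -> P1 A = (\int[P0]_(x in A) (f x)%:E)%E].

Section density_on.
Context d (T : measurableType d) (R : realType) (P1 P0 : probability T R).
Context (G : subSigmaAlgebra T) (f : T -> R) (df : density_on P1 P0 G f).
Local Open Scope ereal_scope.

Lemma integral_density_on (g : T -> \bar R) (A : set T) :
  measurable_wrt G g -> (forall x, 0 <= g x) -> subsigma_sets G A ->
  \int[P1]_(x in A) g x = \int[P0]_(x in A) (g x * (f x)%:E).
Proof.
move=> mg g0 GA; have [mf f0 fE] := df.
rewrite -(@eq_integral_mule _ _ _ G P1 P0 (cst 1))//.
- by apply: eq_integral => x _; rewrite mule1.
- exact: measurable_wrt_fun mf.
- by move=> B GB; rewrite integral_cst ?mul1e -?fE//; exact: (subsigma_sub GB).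
Qed.

Lemma density_on_gt0 : P1 (~` [set x | 0 < f x]%R) = 0.
Proof.
have [mf f0 fE] := df.
have fB : ~` [set x | 0 < f x]%R = (EFin \o f) @^-1` [set 0].
  apply/seteqP; split=> x /=; last by case=> ->; rewrite ltxx.
  move/negP; rewrite -leNgt => fx; congr EFin.
  by apply/eqP; rewrite eq_le fx f0.
rewrite fB fE; last exact: subsigma_preimage.
rewrite (eq_integral (cst 0)) ?integral0// => x; rewrite inE.
exact.
Qed.

Lemma density_on_null (A : set T) : subsigma_sets G A -> P0 A = 0 -> P1 A = 0.
Proof.
move=> GA PA; have [mf f0 fE] := df; rewrite fE//.
rewrite -[RHS](@integral_abs_eq0 _ _ _ P0 A (EFin \o f))//.
- by apply: eq_integral => x _; rewrite gee0_abs// lee_fin.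
- exact: subsigma_sub GA.
- by apply: measurable_funTS; exact: measurable_wrt_fun mf.
Qed.

End density_on.

(** * One step of the likelihood ratio, with [G] as F_{n-1} and [H] as F_n *)

Section likelihood_ratio_step.
Context d (T : measurableType d) (R : realType) (P1 P0 : probability T R).
Context (G H : subSigmaAlgebra T) (GH : G `<=` H).
Context (L : nat -> T -> R) (n : nat).
Context (dG : density_on P1 P0 G (L n.-1)) (dH : density_on P1 P0 H (L n)).
Context (beta : R) (beta_gt0 : 0 < beta) (beta_le1 : beta <= 1).
Context (Z : T -> \bar R).
Context (cZ : is_cond_exp P0 G (lik_ratio_pow L beta n) Z).
Local Open Scope ereal_scope.

Let X := lik_ratio_pow L beta n.
Let E := lik_ratio_tilt L beta n Z.

Let mZ : measurable_wrt G Z. Proof. by have [] := cZ. Qed.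
Let Z0 x : 0 <= Z x. Proof. by have [] := cZ. Qed.
Let mZT : measurable_fun setT Z. Proof. exact: measurable_wrt_fun mZ. Qed.

Lemma lik_ratio_ge0 x : (0 <= lik_ratio L n x)%R.
Proof.
have [_ L'0 _] := dG; have [_ L0 _] := dH.
by rewrite /lik_ratio; case: ifPn => // _; exact: divr_ge0.
Qed.

Let X0 x : 0 <= X x. Proof. by rewrite lee_fin powR_ge0. Qed.

Lemma measurable_lik_ratio_pow : measurable_wrt H X.
Proof.
have [mL' L'0 _] := dG; have [mL L0 _] := dH.
suff mr : measurable_wrt H (EFin \o lik_ratio L n).
  exact: measurableT_comp (measurable_poweR beta) mr.
rewrite (_ : _ \o _ = (fun x => if 0 < (L n.-1 x)%:E then
    (L n x)%:E * (L n.-1 x)%:E^-1 else 1)); last first.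
  apply/funext => x; rewrite /= /lik_ratio lte_fin; case: ifPn => // L'x.
  by rewrite inver gt_eqF// EFinM.
have mL'H : measurable_wrt H (EFin \o L n.-1) by exact: measurable_wrtS mL'.
apply: measurable_fun_ifT => //; first exact: measurable_fun_lte.
by apply: emeasurable_funM => //; exact: measurable_inve_ge0.
Qed.

Let mX : measurable_fun setT X.
Proof. exact: measurable_wrt_fun measurable_lik_ratio_pow. Qed.

(** For beta in (0,1], r^beta is at most 1 if r <= 1 and at most r otherwise. The bound serves to
    integrate [X]; its factor 1/L_{n-1} is [G]-measurable and can be pulled out. *)
Lemma lik_ratio_pow_le x : X x <= 1 + (L n.-1 x)%:E^-1 * (L n x)%:E.
Proof.
have [_ L'0 _] := dG; have [_ L0 _] := dH.
have Lv0 : 0 <= (L n.-1 x)%:E^-1 * (L n x)%:E.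
  by rewrite mule_ge0// ?inve_ge0 lee_fin.
rewrite /X /lik_ratio_pow /lik_ratio; case: ifPn => L'x; last first.
  by rewrite powR1 leeDl.
rewrite inver gt_eqF// -EFinM -EFinD lee_fin [(_^-1 * _)%R]mulrC.
set r := (_ / _)%R; have r0 : (0 <= r)%R by exact: divr_ge0.
have [r1|r1] := leP r 1%R.
  rewrite (le_trans (y := 1%R))// ?lerDl//.
  have <- : (1 `^ beta = 1 :> R)%R by rewrite powR1.
  by apply: ge0_ler_powR; rewrite ?nnegrE//; exact: ltW.
by rewrite (le_trans (ler_powR (ltW r1) beta_le1))// powRr1// lerDr.
Qed.

Let D : set T := [set x | 0 < Z x < +oo].

Let GD : subsigma_sets G D.
Proof.
have -> : D = (Z @^-1` (~` [set 0])) `&` (Z @^-1` (~` [set +oo])).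
  apply/seteqP; split => x /= => [/andP[Z0x Zoo]|[/eqP Z0x /eqP Zoo]].
    by split => Zx; [move: Z0x|move: Zoo]; rewrite Zx ltxx.
  by rewrite /D /= lt_neqAle eq_sym Z0x Z0 ltey.
by apply: subsigmaI; apply: subsigma_preimage => //; exact: measurableC.
Qed.

(** The P0-integral of [Z] equals that of [X], which is at most 2 by [lik_ratio_pow_le]. Thus [Z] is
    finite P0-a.s., and P0-null sets of [G] are P1-null. *)
Lemma cond_exp_lik_ratio_pow_lty : P1 (Z @^-1` [set +oo]) = 0.
Proof.
have [mL' L'0 _] := dG; have [mL L0 _] := dH; have [_ _ ZE] := cZ.
have mL'T := measurable_wrt_fun mL'; have mLT := measurable_wrt_fun mL.
have L'inv0 x : 0 <= (L n.-1 x)%:E^-1 by rewrite inve_ge0 lee_fin.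
have mL'inv : measurable_wrt G (fun x => (L n.-1 x)%:E^-1).
  by apply: measurable_inve_ge0 => // x; rewrite lee_fin.
have mL'invT := measurable_wrt_fun mL'inv.
have GZ : subsigma_sets G (Z @^-1` [set +oo]) by exact: subsigma_preimage.
apply: (density_on_null dG) => //.
(* Both densities give P1 on [G], so pull-out replaces L_n by L_{n-1}; the product with the inverse
   is then 1, or +oo * 0 = 0 where L_{n-1} vanishes. *)
have LE : \int[P0]_x ((L n.-1 x)%:E^-1 * (L n x)%:E) <= 1.
  rewrite (@eq_integral_mule _ _ _ G P0 P0 _ (EFin \o L n.-1))//; last 2 first.
  - move=> A GA; have [_ _ <-//] := dG; have [_ _ <-//] := dH; exact: GH.
  - exact: subsigmaT.
  rewrite -(@probability_setT _ _ _ P0) -[leRHS]mul1e -integral_cst//.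
  apply: ge0_le_integral => //.
  - by move=> x _; rewrite mule_ge0// lee_fin.
  - exact: emeasurable_funM.
  - move=> x _ /=; rewrite inver; case: eqP => [->|/eqP L'x].
      by rewrite mule0.
    by rewrite -EFinM mulVf.
have ZT : \int[P0]_x Z x < +oo.
  rewrite ZE; last exact: subsigmaT.
  apply: (@le_lt_trans _ _ (\int[P0]_x (1 + (L n.-1 x)%:E^-1 * (L n x)%:E))).
    apply: ge0_le_integral => //; last by move=> x _; exact: lik_ratio_pow_le.
    by apply: emeasurable_funD => //; exact: emeasurable_funM.
  rewrite ge0_integralD//; last 2 first.
  - by move=> x _; rewrite mule_ge0// lee_fin.
  - exact: emeasurable_funM.
  rewrite lte_add_pinfty//; last exact: le_lt_trans LE (ltry _).
  rewrite integral_cst// mul1e.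
  by rewrite (le_lt_trans (probability_le1 _ _))// ltry.
have iZ : P0.-integrable setT Z.
  apply/integrableP; split => //; apply: le_lt_trans ZT.
  apply: ge0_le_integral => //; first exact: measurableT_comp.
  by move=> x _; rewrite gee0_abs.
apply/negligibleP; first exact: subsigma_sub GZ.
apply: negligibleS (integrable_ae measurableT iZ) => x /= Zx /(_ I).
by rewrite Zx.
Qed.

(** On [Z = 0] the nonnegative [X] has P0-integral 0, so R_n = 0 P0-a.s. there. This excludes
    L_{n-1} = 0, where R_n is 1, and hence forces L_n = 0. *)
Lemma cond_exp_lik_ratio_pow_gt0 : P1 (Z @^-1` [set 0]) = 0.
Proof.
have [mL' L'0 _] := dG; have [mL L0 LE] := dH; have [_ _ ZE] := cZ.
have mLT := measurable_wrt_fun mL.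
set A := _ @^-1` _; have GA : subsigma_sets G A by exact: subsigma_preimage.
have mA := subsigma_sub GA.
(* The event lies in [G], but its P1-mass is computed with the density L_n on [H], the one shown to
   vanish there. *)
rewrite LE; last exact: GH.
have : \int[P0]_(x in A) `|X x| = 0.
  under eq_integral do rewrite gee0_abs//.
  by rewrite -ZE// (eq_integral (cst 0)) ?integral0// => x; rewrite inE.
move/(ae_eq_integral_abs _ mA (measurable_funTS mX)) => X_eq0.
rewrite -[RHS](@integral0 _ _ _ P0 A); apply: ge0_ae_eq_integral => //.
- exact: measurable_funTS.
- by move=> x _; rewrite lee_fin.
apply: filterS X_eq0 => x /[apply] -[/eqP]; rewrite powR_eq0 => /andP[+ _].
rewrite /lik_ratio; case: ifPn => L'x; last by rewrite oner_eq0.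
by rewrite mulf_eq0 invr_eq0 (gt_eqF L'x) orbF => /eqP ->.
Qed.

Let P1D : P1 (~` D) = 0.
Proof.
have -> : ~` D = Z @^-1` [set 0] `|` Z @^-1` [set +oo].
  apply/seteqP; split => x /=; last by case=> Zx; rewrite /D /= Zx ltxx ?andbF.
  move/negP; rewrite negb_and -leNgt -leNgt => /orP[Zx|].
    by left; apply/eqP; rewrite eq_le Zx Z0.
  by rewrite leye_eq => /eqP; right.
have [GZ0 GZy] : subsigma_sets G (Z @^-1` [set 0]) /\
    subsigma_sets G (Z @^-1` [set +oo]).
  by split; exact: subsigma_preimage.
apply: null_set_setU; [exact: subsigma_sub GZ0|exact: subsigma_sub GZy| |].
  exact: cond_exp_lik_ratio_pow_gt0.
exact: cond_exp_lik_ratio_pow_lty.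
Qed.

Lemma measurable_lik_ratio_tilt : measurable_wrt H E.
Proof.
have mZH : measurable_wrt H Z by exact: measurable_wrtS mZ.
apply: measurable_fun_ifT => //.
  by apply: measurable_and; exact: measurable_fun_lte.
apply: emeasurable_funM; first exact: measurable_lik_ratio_pow.
exact: measurable_inve_ge0.
Qed.

Lemma cond_exp_lik_ratio_tilt : is_cond_exp P0 G E (cst 1).
Proof.
split; [exact: measurable_cst|by []|move=> A GA].
have [mA mD] := (subsigma_sub GA, subsigma_sub GD).
have mE := measurable_wrt_fun measurable_lik_ratio_tilt.
have [_ _ ZE] := cZ.
rewrite (@ge0_integral_setIC _ _ _ _ _ _ D)//.
rewrite [RHS](@ge0_integral_setIC _ _ _ _ _ _ D)//;
  last by move=> x; exact: lik_ratio_tilt_ge0.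
(* Off [D] the tilted ratio has the default value 1, so equality holds there too. *)
congr (_ + _); last first.
  apply: eq_integral => x; rewrite inE => -[_ /negP Dx].
  by rewrite /E /lik_ratio_tilt (negbTE Dx).
(* Writing 1 as Z^{-1} Z, legitimate on [D], creates a factor [Z] that pull-out exchanges for
   [X]. *)
transitivity (\int[P0]_(x in A `&` D) ((Z x)^-1 * Z x)).
  apply: eq_integral => x; rewrite inE => -[_ /= /andP[Z0x Zoo]].
  by rewrite muleC divee ?gt_eqF// ge0_fin_numE.
rewrite (@eq_integral_mule _ _ _ G P0 P0 _ X)//.
- apply: eq_integral => x; rewrite inE => -[_ Dx].
  by rewrite /E /lik_ratio_tilt Dx muleC.
- exact: measurable_inve_ge0.
- by move=> x; rewrite inve_ge0.
- exact: subsigmaI.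
Qed.

Let s := ((1 - beta) / beta)%R.

(* Where L_n = 0 the left-hand side is [+oo * 0] for s > 0, which is 0. *)
Lemma negpow_lik_ratio_tilt x : D x -> (0 < L n.-1 x)%R ->
  negpow (E x) s * (L n x)%:E = (Z x `^ s * (L n.-1 x)%:E) * X x.
Proof.
move=> Dx L'x; have /andP[Z0x Zoo] := Dx; have [_ L0 _] := dH.
rewrite /E /lik_ratio_tilt Dx /X /lik_ratio_pow.
have -> : L n x = (lik_ratio L n x * L n.-1 x)%R.
  by rewrite /lik_ratio L'x divfK// gt_eqF.
case: (Z x) Z0x Zoo => [z| |]//; rewrite lte_fin => z0 _.
rewrite inver gt_eqF// -EFinM; move: (lik_ratio_ge0 x).
rewrite le_eqVlt => /predU1P[<-|r0].
  by rewrite mul0r powR0 ?gt_eqF// !mule0.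
set r := lik_ratio _ _ _ in r0 *; rewrite /negpow /=.
have b0 : (0 < r `^ beta)%R by exact: powR_gt0.
rewrite inver gt_eqF; last by rewrite powR_gt0// divr_gt0.
rewrite -!EFinM; congr EFin.
(* The exponent of r is - beta s = beta - 1; the factor r of L_n then raises it to beta. *)
have -> : ((r `^ beta / z) `^ s)^-1%R = (z `^ s * r `^ (beta - 1))%R.
  rewrite -powR_inv1 ?powR_ge0// -powRrM mulrN1 powRM ?invr_ge0 ?ltW//.
  rewrite -[in (z^-1)%R]powR_inv1 ?ltW// -!powRrM mulN1r opprK mulrC.
  by congr (_ * _ `^ _)%R; rewrite mulrN /s mulrC divfK ?gt_eqF// opprB.
have -> : (r `^ beta = r `^ (beta - 1) * r)%R.
  rewrite -[X in (_ = _ * X)%R](powRr1 (ltW r0)) -powRD ?subrK//.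
  by rewrite (gt_eqF r0) implybT.
by rewrite -!mulrA; congr (_ * _)%R; rewrite mulrA mulrC.
Qed.

Lemma measurable_negpow_lik_ratio_tilt :
  measurable_wrt H (fun x => negpow (E x) s).
Proof.
apply: measurable_inve_ge0 => [|x]; last exact: poweR_ge0.
exact: measurableT_comp (measurable_poweR s) measurable_lik_ratio_tilt.
Qed.

Lemma cond_exp_negpow_lik_ratio_tilt :
  is_cond_exp P1 G (fun x => negpow (E x) s) (fun x => Z x `^ beta^-1).
Proof.
have [mL' L'0 _] := dG; have [_ _ ZE] := cZ.
have mN := measurable_negpow_lik_ratio_tilt.
have N0 x : 0 <= negpow (E x) s by rewrite inve_ge0 poweR_ge0.
have mZp (a : R) : measurable_wrt G (fun x => Z x `^ a).
  exact: measurableT_comp (measurable_poweR a) mZ.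
split => // [x|A GA]; first exact: poweR_ge0.
(* The event of full P1-measure on which [negpow_lik_ratio_tilt] applies; it lies in [G], so
   intersecting with it keeps test sets in [G]. *)
pose B := D `&` [set x | 0 < L n.-1 x]%R.
have GL' : subsigma_sets G [set x | 0 < L n.-1 x]%R.
  apply: (@subsigma_preimage _ _ _ _ (EFin \o L n.-1) [set y | 0 < y]) => //.
  by rewrite -set_itvoy; exact: emeasurable_itv.
have GB : subsigma_sets G B by exact: subsigmaI.
have GAB := subsigmaI GA GB.
have [mA mB] := (subsigma_sub GA, subsigma_sub GB).
have PB : P1 (~` B) = 0.
  rewrite setCI; apply: null_set_setU => //; last exact: density_on_gt0 dG.
  - by apply: measurableC; exact: subsigma_sub GD.
  - by apply: measurableC; exact: subsigma_sub GL'.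
rewrite (ge0_integral_full mA mB _ _ PB)
  ?[RHS](ge0_integral_full mA mB _ _ PB)//;
  [|exact: measurable_wrt_fun mN|exact: measurable_wrt_fun (mZp _)
   |by move=> x; exact: poweR_ge0].
(* The power of [Z] is [G]-measurable and takes the density L_{n-1}; the tilted ratio is measurable
   for [H] and takes L_n. *)
rewrite (integral_density_on dG)//; last by move=> x; exact: poweR_ge0.
rewrite (integral_density_on dH)//; last exact: GH.
(* Since 1/beta = s + 1, one factor [Z] splits off, to be exchanged for [X] against the
   [G]-measurable Z^s L_{n-1}. *)
transitivity (\int[P0]_(x in A `&` B) (Z x `^ s * (L n.-1 x)%:E * Z x)).
  apply: eq_integral => x; rewrite inE => -[_ [/= /andP[Z0x Zoo] L'x]].
  rewrite muleAC; congr (_ * _); case: (Z x) Z0x Zoo => [z| |]//.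
  rewrite lte_fin => z0 _; rewrite /= -EFinM -[X in (_ * X)%R]powRr1 ?ltW//.
  rewrite -powRD; last first.
    by rewrite (gt_eqF z0) implybT.
  by congr (_ `^ _)%:E; rewrite /s mulrBl mul1r divff ?gt_eqF// subrK.
rewrite -(@eq_integral_mule _ _ _ G P0 P0 X Z)//.
- apply: eq_integral => x; rewrite inE => -[_ [Dx L'x]].
  by rewrite -negpow_lik_ratio_tilt.
- by move=> C GC; rewrite ZE.
- exact: emeasurable_funM (mZp s) mL'.
- by move=> x; rewrite mule_ge0 ?poweR_ge0// lee_fin.
Qed.

End likelihood_ratio_step.

Unset Implicit Arguments.

(** * From the filtration to the single step, and to arbitrary versions *)

Theorem lemmaA5 (R : realType) (d : measure_display) (T : measurableType d)
  (F : nat -> subSigmaAlgebra T) (P0 P1 : probability T R)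
  (F_filtration : is_filtration F)
  (F0_trivial : (F 0%N : set (set T)) = [set set0; setT])
  (P1_ac : forall t, (0 < t)%N -> prestr P1 (F t) `<< prestr P0 (F t))
  (P1_KL : forall t, (0 < t)%N ->
    (KL (prestr P1 (F t)) (prestr P0 (F t)) < +oo)%E)
  (L : nat -> T -> R)
  (L0 : forall x, L 0%N x = 1)
  (L_density : forall t, (0 < t)%N ->
    is_density (prestr P1 (F t)) (prestr P0 (F t)) (L t))
  (beta : R) (beta_range : 0 < beta <= 1) (n : nat) (n_gt0 : (0 < n)%N)
  (Z : T -> \bar R)
  (Z_version : is_cond_exp P0 (F n.-1) (lik_ratio_pow L beta n) Z) :
  cond_evariable P0 F n (lik_ratio_tilt L beta n Z) /\
  (forall W : T -> \bar R,
    is_cond_exp P1 (F n.-1)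
      (fun x => negpow (lik_ratio_tilt L beta n Z x) ((1 - beta) / beta)) W ->
    {ae P1, forall x, W x = expeR (- lambda beta Z x)%E}).
Proof.
have /andP[beta_gt0 beta_le1] := beta_range.
(* Time 0 is included so that n = 1 is no special case: on the trivial F_0 both measures agree and
   L_0 = 1 is a density. *)
have dL t : density_on P1 P0 (F t) (L t).
  case: t => [|t].
    split => [|x|A].
    - rewrite (_ : _ \o _ = cst 1%E); first exact: measurable_cst.
      by apply/funext => x /=; rewrite L0.
    - by rewrite L0.
    under eq_integral do rewrite L0.
    rewrite F0_trivial => -[->|->]; first by rewrite integral_set0 measure0.
    by rewrite integral_cst// mul1e [LHS]probability_setT;
      exact/esym/probability_setT.
  have [mLt Lt0 LtE] := L_density t.+1 isT.
  have mLt' : measurable_wrt (F t.+1) (EFin \o L t.+1).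
    exact/measurable_EFinP.
  split => // A FA; rewrite -(@integral_prestr _ _ _ P0 (F t.+1))//.
  by rewrite -LtE// measurable_subsigma.
have FS : F n.-1 `<=` F n by apply: F_filtration; exact: leq_pred.
have dG := dL n.-1; have dH := dL n.
split; first split.
- exact: (measurable_lik_ratio_tilt FS dG dH Z_version).
- by move=> x; apply: lik_ratio_tilt_ge0; have [_ + _] := Z_version; exact.
(* The constant 1 is one version, so by uniqueness every version equals 1 P0-a.s. *)
- move=> Y cY; have c1 := cond_exp_lik_ratio_tilt FS dG dH Z_version.
  by apply: filterS (cond_exp_ae_unique cY c1) => x ->.
move=> W cW.
have cV := cond_exp_negpow_lik_ratio_tilt FS dG dH beta_gt0 beta_le1 Z_version.
apply: filterS (cond_exp_ae_unique cW cV) => x ->.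
by rewrite expeR_lambda//; have [_ + _] := Z_version; exact.
Qed.
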